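(* Let $\dot A$ be a densely defined closed symmetric operator with deficiency indices $(1,1)$ in a Hilbert space $\mathcal H$, with $(+)$-normalized deficiency vectors $g_\pm\in\operatorname{Ker}(\dot A^*\mp iI)$. Let $\Theta$ be an L-system with symmetric operator $\dot A$, main operator $T\neq T^*$ (a maximal dissipative extension of $\dot A$) and quasi-kernel $\hat A$ of $\operatorname{Re}\mathbb A$, such that $g_+-\kappa g_-\in\operatorname{Dom}(T)$ for some $0\le\kappa<1$ and $g_++g_-\in\operatorname{Dom}(\hat A)$. Assume that $\Theta$ has finite c-Entropy $\mathcal S$. Then for every real $Q\neq0$ the c-Entropy $\mathcal S(Q)$ of the perturbed L-system $\Theta(Q)$ is finite and $$\mathcal S(Q)=\ln\frac{\left(b-2Q^2+\sqrt{b^2+4Q^2}\right)^2+a\left(b+\sqrt{b^2+4Q^2}\right)^2+4Q^2a(a+1)}{a\left(b+\sqrt{b^2+4Q^2}\right)^2-\left(b-2Q^2+\sqrt{b^2+4Q^2}\right)^2-4Q^2a(a-1)},$$ where $a=\coth\left(\frac{\mathcal S}{2}\right)$ and $b=Q^2+a^2-1$.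
   Context: Rigged space: for a densely defined closed symmetric operator $\dot A$ in $\mathcal H$, let $\mathcal H_+=\operatorname{Dom}(\dot A^* )$ with inner product $(f,g)_+=(f,g)+(\dot A^*f,\dot A^*g)$, and let $\mathcal H_-$ be its dual, giving $\mathcal H_+\subset\mathcal H\subset\mathcal H_-$. $[\mathcal H_1,\mathcal H_2]$ denotes bounded linear operators from $\mathcal H_1$ to $\mathcal H_2$. If $\mathbb A\in[\mathcal H_+,\mathcal H_-]$ then $\mathbb A^*\in[\mathcal H_+,\mathcal H_-]$; put $\operatorname{Re}\mathbb A=\frac12(\mathbb A+\mathbb A^* )$, $\operatorname{Im}\mathbb A=\frac1{2i}(\mathbb A-\mathbb A^* )$. ''$(+)$-normalized'' means $\|g_\pm\|_+=1$ (note $\|g_\pm\|_+^2=2\|g_\pm\|^2$). An operator $T$ is dissipative if $\operatorname{Im}(Tf,f)\ge 0$ for all $f\in\operatorname{Dom}(T)$. $( * )$-extension: for $T$ with $\dot A\subset T\subset\dot A^*$, an operator $\mathbb A\in[\mathcal H_+,\mathcal H_-]$ is a $( * )$-extension of $T$ if $\dot A\subset T\subset\mathbb A$, $\dot A\subset T^*\subset\mathbb A^*$ and the quasi-kernel $\hat A$ of $\operatorname{Re}\mathbb A$, i.e. the restriction of $\operatorname{Re}\mathbb A$ to $\{f\in\mathcal H_+:(\operatorname{Re}\mathbb A)f\in\mathcal H\}$, is a self-adjoint extension of $\dot A$ in $\mathcal H$. L-system: given $\dot A$ with deficiency indices $(1,1)$ and a dissipative $T$ with $\dot A\subset T\subset\dot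 A^*$, an L-system $\Theta$ with symmetric operator $\dot A$ and main operator $T$ consists of the rigged space above, a $( * )$-extension $\mathbb A$ of $T$ (the state-space operator), and $K\in[\mathbb C,\mathcal H_-]$ with $K^*\in[\mathcal H_+,\mathbb C]$ and $\operatorname{Im}\mathbb A=KK^*$. Its transfer function is $W_\Theta(z)=I-2iK^*(\mathbb A-zI)^{-1}K$, $z\in\rho(T)$, and its impedance function is $V_\Theta(z)=K^*(\operatorname{Re}\mathbb A-zI)^{-1}K$; for $z\in\rho(T)$, $\operatorname{Im}z\ne0$, they are related by $V_\Theta(z)=i[W_\Theta(z)+I]^{-1}[W_\Theta(z)-I]$ and $W_\Theta(z)=(I+iV_\Theta(z))^{-1}(I-iV_\Theta(z))$. Perturbation: for $Q\in\mathbb R\setminus\{0\}$, the perturbed L-system $\Theta(Q)$ (the perturbation of $\Theta$) is an L-system with the same symmetric operator $\dot A$ as $\Theta$ whose impedance function satisfies the impedance shift formula $V_{\Theta(Q)}(z)=Q+V_\Theta(z)$. c-Entropy: the c-Entropy of an L-system $\Theta$ is $\mathcal S=-\ln|W_\Theta(-i)|$ (equal to $+\infty$ when $W_\Theta(-i)=0$). *)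

(* Defs.v *)
From HB Require Import structures.
From mathcomp Require Import all_boot all_order all_algebra.
From mathcomp Require Import sesquilinear complex.
From mathcomp Require Import all_classical all_reals all_analysis.
From mathcomp Require Import ring.

Set Implicit Arguments.
Unset Strict Implicit.
Unset Printing Implicit Defensive.

Import Order.TTheory GRing.Theory Num.Theory numFieldNormedType.Exports.

Local Open Scope classical_set_scope.
Local Open Scope complex_scope.
Local Open Scope ring_scope.

(* Inner products are linear in the first argument and conjugate-linear in the
   second. A possibly unbounded operator is identified with its graph, a set of
   pairs (f, T f) in H * H, so that inclusion of graphs is extension of
   operators. *)
Section UnboundedOperators.
Context {R : realType} {H : completeNormedModType R[i]}.
Variable ip : {dot H for Num.conj}.
Implicit Types (T : set (H * H)) (f g k : H).

Definition operator T :=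
  submod_closed (mem T) /\ (forall k, T (0, k) -> k = 0).

Definition opdom T : set H := [set f | exists k, T (f, k)].

Definition opapp T f : H := xget 0 [set k | T (f, k)].

(* The graph of the Hilbert space adjoint; it is single-valued exactly when
   opdom T is dense. *)
Definition adjoint T : set (H * H) :=
  [set p | forall f k, T (f, k) -> ip k p.1 = ip f p.2].

Definition symmetric_operator T := operator T /\ T `<=` adjoint T.

Definition self_adjoint T := operator T /\ T = adjoint T.

Definition dissipative T := forall f k, T (f, k) -> 0 <= 'Im (ip k f).

Definition maximal_dissipative T :=
  [/\ operator T, dissipative T &
      forall T', operator T' -> dissipative T' -> T `<=` T' -> T' = T].

Definition has_dim (V : set H) (n : nat) :=
  exists2 b : 'I_n -> H,
    (forall c : 'I_n -> R[i], \sum_(j < n) c j *: b j = 0 -> forall j, c j = 0) &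
    V = [set f | exists c : 'I_n -> R[i], f = \sum_(j < n) c j *: b j].

(* Ker (T - z I) *)
Definition eigenset T (z : R[i]) : set H := [set f | T (f, z *: f)].

Definition deficiency_indices T (n m : nat) :=
  has_dim (eigenset (adjoint T) 'i) n /\ has_dim (eigenset (adjoint T) (- 'i)) m.

Lemma adjointP a T (p q : H * H) :
  adjoint T p -> adjoint T q -> adjoint T (a *: p + q).
Proof.
move=> Tp Tq f k Tfk /=.
by rewrite !linearDr /= !linearZr_LR /= (Tp _ _ Tfk) (Tq _ _ Tfk).
Qed.

Lemma adjoint0 T : adjoint T 0.
Proof. by move=> f k _ /=; rewrite !linear0r. Qed.

Lemma cauchy_schwarz f g : `|ip f g| ^+ 2 <= ip f f * ip g g.
Proof.
have [->|g0] := eqVneq g 0; first by rewrite !linear0r normr0 expr0n /=.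
have gg0 : 0 < ip g g by apply: neq0_dnorm_gt0.
have := dnorm_ge0 ip (ip g g *: f - ip f g *: g).
have fgC : ip g f = (ip f g)^*.
  by rewrite (@hermitian_subproof _ _ _ _ ip) expr0 mul1r.
have ggC : (ip g g)^* = ip g g.
  by apply: conj_Creal; apply: ger0_real; apply: ltW.
rewrite linearBl /= !linearBr /= !linearZl_LR /= !linearZr_LR /= ggC fgC.
rewrite normCK => h.
have : 0 <= ip g g * (ip f f * ip g g - ip f g * (ip f g)^*).
  by move: h; rewrite /GRing.scale /=; congr (_ <= _); ring.
by rewrite pmulr_rge0 // subr_ge0.
Qed.

End UnboundedOperators.

(* The rigged space H_+ c H c H_- generated by a densely defined A. *)
Section RiggedSpace.
Context {R : realType} {H : completeNormedModType R[i]}.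
Variables (ip : {dot H for Num.conj}) (A : set (H * H)).

Definition Hplus_pred : {pred H} := mem (opdom (adjoint ip A)).

Lemma Hplus_submod : submod_closed Hplus_pred.
Proof.
split=> [|a f g]; rewrite !inE.
  by exists 0; apply: adjoint0.
move=> [k fk] [l gl]; exists (a *: k + l).
exact: (adjointP a fk gl).
Qed.

HB.instance Definition _ := GRing.isSubmodClosed.Build _ _ Hplus_pred Hplus_submod.

Record Hplus := HPlus { hp_val : H; _ : hp_val \in Hplus_pred }.
HB.instance Definition _ := [isSub for hp_val].
HB.instance Definition _ := [Choice of Hplus by <:].
HB.instance Definition _ := [SubChoice_isSubLmodule of Hplus by <:].

Definition ip_plus (f g : Hplus) : R[i] :=
  ip (hp_val f) (hp_val g) +
  ip (opapp (adjoint ip A) (hp_val f)) (opapp (adjoint ip A) (hp_val g)).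

Definition norm_plus (f : Hplus) : R[i] := sqrtC (ip_plus f f).

(* H_- consists of the bounded conjugate-linear functionals on H_+ ; the value
   psi g is the pairing (psi, g), which extends the inner product of H. *)
Definition Hminus_pred : {pred Hplus -> R[i]^o} := mem
  [set psi : Hplus -> R[i]^o | linear_for (Num.conj \; *%R) psi /\
     exists M : R[i], forall g, `|psi g| <= M * norm_plus g].

Lemma Hminus_submod : submod_closed Hminus_pred.
Proof.
split=> [|a f g]; rewrite !inE.
  split; first by move=> c u v /=; rewrite /GRing.zero /= mulr0 addr0.
  by exists 0 => g; rewrite mul0r normr0.
move=> [fl [M fM]] [gl [N gN]]; split=> [c u v|].
  by rewrite !fctE fl gl /= scalerDr mulrDr -!scalerAr addrACA.
exists (`|a| * M + N) => u; rewrite mulrDl -mulrA.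
apply: (le_trans (ler_normD _ _)); apply: lerD => //.
by rewrite normrM ler_wpM2l.
Qed.

HB.instance Definition _ :=
  GRing.isSubmodClosed.Build _ _ Hminus_pred Hminus_submod.

Record Hminus :=
  HMinus { hm_val :> Hplus -> R[i]^o; _ : hm_val \in Hminus_pred }.
HB.instance Definition _ := [isSub for hm_val].
HB.instance Definition _ := [Choice of Hminus by <:].
HB.instance Definition _ := [SubChoice_isSubLmodule of Hminus by <:].

Lemma emb_subproof (h : H) : ((fun g : Hplus => ip h (hp_val g)) : _ -> _^o) \in Hminus_pred.
Proof.
rewrite inE; split=> [c u v /=|]; first by rewrite linearDr linearZr_LR.
exists (sqrtC (ip h h)) => g.
rewrite -[X in X <= _]sqrCK // -rootCMl ?dnorm_ge0 // ler_sqrtC ?qualifE /=.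
- apply: (le_trans (cauchy_schwarz _ _ _)); apply: ler_wpM2l.
    exact: dnorm_ge0.
  by rewrite lerDl dnorm_ge0.
- by rewrite exprn_ge0.
- by rewrite mulr_ge0 ?addr_ge0 ?dnorm_ge0.
Qed.

Definition emb (h : H) : Hminus := HMinus (emb_subproof h).

(* [H_+, H_-] *)
Record bop := BOp {
  bop_fun :> {linear Hplus -> Hminus};
  bop_bounded : exists M : R[i], forall f g,
    `|bop_fun f g| <= M * norm_plus f * norm_plus g }.

Lemma bop_adj_subproof (B : bop) (f : Hplus) :
  ((fun g : Hplus => (B g f)^*) : _ -> _^o) \in Hminus_pred.
Proof.
rewrite inE; split=> [c u v /=|].
  by rewrite linearP /= rmorphD rmorphM.
have [M BM] := bop_bounded B.
exists (M * norm_plus f) => g; rewrite norm_conjC.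
by rewrite mulrAC.
Qed.

(* (B^* f, g) = (f, B g) *)
Definition bop_adj_fun (B : bop) (f : Hplus) : Hminus :=
  HMinus (bop_adj_subproof B f).

Lemma bop_adj_linear (B : bop) : linear (bop_adj_fun B).
Proof.
move=> a u v; apply: val_inj; apply/funext => g /=.
have /set_mem [Bl _] := valP (B g).
by rewrite Bl rmorphD rmorphM /= conjCK.
Qed.

HB.instance Definition _ (B : bop) :=
  GRing.isLinear.Build _ _ _ _ (bop_adj_fun B) (bop_adj_linear B).

Lemma bop_adj_bounded (B : bop) : exists M : R[i], forall f g,
  `|bop_adj_fun B f g| <= M * norm_plus f * norm_plus g.
Proof.
have [M BM] := bop_bounded B; exists M => f g.
by rewrite norm_conjC mulrAC.
Qed.

Definition bop_adj (B : bop) : bop := BOp (bop_adj_bounded B).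

Definition bop_Re (B : bop) : Hplus -> Hminus :=
  fun f => 2^-1 *: (B f + bop_adj B f).

Definition bop_Im (B : bop) : Hplus -> Hminus :=
  fun f => (2 * 'i)^-1 *: (B f - bop_adj B f).

(* The restriction of B to {f in H_+ | B f in H}, as an operator in H. *)
Definition restrict_to_H (B : Hplus -> Hminus) : set (H * H) :=
  [set p | exists2 f : Hplus, hp_val f = p.1 & B f = emb p.2].

Definition quasi_kernel (B : bop) : set (H * H) := restrict_to_H (bop_Re B).

Definition star_extension (T : set (H * H)) (B : bop) :=
  [/\ A `<=` T /\ T `<=` restrict_to_H B,
      A `<=` adjoint ip T /\ adjoint ip T `<=` restrict_to_H (bop_adj B) &
      self_adjoint ip (quasi_kernel B) /\ A `<=` quasi_kernel B].

(* (B - z I)^{-1} psi; by convention 0 when the equation has no solution. *)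
Definition resolvent (B : Hplus -> Hminus) (z : R[i]) (psi : Hminus) : Hplus :=
  xget 0 [set f | B f - z *: emb (hp_val f) = psi].

(* K^* : H_+ -> C for K : C -> H_-, determined by K^* f * c^* = (f, K c);
   a linear map on C is automatically bounded. *)
Definition channel_adj (K : {linear R[i]^o -> Hminus}) (f : Hplus) : R[i]^o :=
  (K 1 f)^*.

Record Lsystem := LSystem {
  main_op : set (H * H);
  main_operator : operator main_op;
  main_dissipative : dissipative ip main_op;
  main_ext : A `<=` main_op /\ main_op `<=` adjoint ip A;
  state_op : bop;
  state_star_ext : star_extension main_op state_op;
  channel : {linear R[i]^o -> Hminus};
  channel_eq : forall f, bop_Im state_op f = channel (channel_adj channel f) }.

(* Operators on C are identified with complex numbers through their value
   at 1. *)
Definition transfer_function (Theta : Lsystem) (z : R[i]) : R[i] :=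
  1 - 2 * 'i * channel_adj (channel Theta)
                 (resolvent (state_op Theta) z (channel Theta 1)).

Definition impedance_function (Theta : Lsystem) (z : R[i]) : R[i] :=
  channel_adj (channel Theta)
    (resolvent (bop_Re (state_op Theta)) z (channel Theta 1)).

Definition perturbation (Q : R) (Theta ThetaQ : Lsystem) :=
  forall z : R[i], 'Im z != 0 ->
    impedance_function ThetaQ z = Q%:C + impedance_function Theta z.

(* Extended-real valued, with lne 0 = -oo. *)
Definition c_entropy (Theta : Lsystem) : \bar R :=
  (- lne (Normc.normc (transfer_function Theta (- 'i)))%:E)%E.

End RiggedSpace.

Definition coth {R : realType} (x : R) : R :=
  (expR x + expR (- x)) / (expR x - expR (- x)).

(* Main.v *)
Require Import Defs.
From HB Require Import structures.
From mathcomp Require Import all_boot all_order all_algebra.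
From mathcomp Require Import sesquilinear complex.
From mathcomp Require Import all_classical all_reals all_analysis.
From mathcomp Require Import ring lra.
Import Order.TTheory GRing.Theory Num.Theory numFieldNormedType.Exports.
Local Open Scope classical_set_scope.
Local Open Scope complex_scope.
Local Open Scope ring_scope.

(* The solution of [(Re A + i) f = K 1] is a multiple of [gm]: on [gp + gm] the
   operator [Re A] acts as the adjoint of [A], on [gp - kappa gm] the state-space
   operator does, and [gm] is a combination of the two. The symmetry of [Re A]
   gives the remaining constants, so that [V (- i) = - i m] with
   [m = (1 + kappa) / (1 - kappa)]. The Cayley relation
   [W = (1 - i V) / (1 + i V)] turns this into [|W (- i)| = kappa], i.e.
   [m = coth (S / 2)], and turns [Q - i m] into
   [|W_Q (- i)|^2 = ((m - 1)^2 + Q^2) / ((m + 1)^2 + Q^2)]. *)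

(** Lets an equation follow from a known one by a single [field] identity between the differences of
    their sides. *)
Lemma eq_from_sub {V : zmodType} {a b : V} (c d : V) : a = b -> c - d = b - a -> c = d.
Proof. by move=> ->; rewrite subrr => /subr0_eq. Qed.

(** * Adjoints of densely defined operators *)

Section Adjoints.
Context {R : realType} {H : completeNormedModType R[i]}.
Variable ip : {dot H for Num.conj}.
Hypothesis ip_norm : forall x : H, ip x x = `|x| ^+ 2.

Lemma ipC (f g : H) : ip g f = (ip f g)^*.
Proof. by rewrite (@hermitian_subproof _ _ _ _ ip) expr0 mul1r. Qed.

(** If [d] were nonzero, some [f] in [D] would lie closer to [d] than [|d|]; but orthogonality and
    Cauchy-Schwarz for [d - f] and [d] give [|d| <= |d - f|]. *)
Lemma dense_orthogonal (D : set H) (d : H) :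
  dense D -> (forall f, D f -> ip f d = 0) -> d = 0.
Proof.
move=> Dd Dort; apply/eqP; rewrite -normr_eq0; apply: contraT => d0.
have dgt0 : 0 < `|d| by rewrite lt_neqAle eq_sym d0 normr_ge0.
have [|f [fb Df]] := Dd (ball d `|d|) _ (ball_open d _).
  by exists d; apply: ballxx.
have := @cauchy_schwarz _ _ ip (d - f) d.
have -> : ip (d - f) d = `|d| ^+ 2 by rewrite linearBl /= (Dort f Df) subr0.
rewrite !ip_norm normrX normr_id -exprMn.
rewrite ler_pXn2r ?nnegrE ?mulr_ge0 ?exprn_ge0 //= expr2 ler_pM2r //.
move: fb; rewrite -ball_normE /= => fb /le_lt_trans/(_ fb).
by rewrite ltxx.
Qed.

Lemma adjoint_fun (T : set (H * H)) f k l :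
  dense (opdom T) -> adjoint ip T (f, k) -> adjoint ip T (f, l) -> k = l.
Proof.
move=> Td Tk Tl; apply/eqP; rewrite -subr_eq0; apply/eqP.
apply: (dense_orthogonal _ _ Td) => g [h gh].
by rewrite linearBr /= -(Tk _ _ gh) -(Tl _ _ gh) subrr.
Qed.

Lemma opapp_adjoint (T : set (H * H)) f k :
  dense (opdom T) -> adjoint ip T (f, k) -> opapp (adjoint ip T) f = k.
Proof. by move=> Td Tk; apply: xget_unique => // l /(adjoint_fun _ _ _ _ Td Tk). Qed.

Lemma adjoint_sub (T T' : set (H * H)) :
  T `<=` T' -> adjoint ip T' `<=` adjoint ip T.
Proof. by move=> TT' p T'p f k /TT'/T'p. Qed.

End Adjoints.

(** * The real part of the state-space operator, impedance and transfer function *)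

Section Impedance.
Context {R : realType} {H : completeNormedModType R[i]}.
Variables (ip : {dot H for Num.conj}) (A : set (H * H)).
Implicit Types (B : bop ip A) (Theta : Lsystem ip A) (f g : Hplus ip A).

Lemma hminusP (psi : Hminus ip A) c f g : psi (c *: f + g) = c^* * psi f + psi g.
Proof. by have /set_mem[-> _] := valP psi. Qed.

Lemma hminusZ (psi : Hminus ip A) c f : psi (c *: f) = c^* * psi f.
Proof.
have psi0 : psi 0 = 0.
  by have := hminusP psi (-1) 0 0; rewrite scaler0 add0r rmorphN rmorph1 mulN1r addNr.
by have := hminusP psi c f 0; rewrite psi0 !addr0.
Qed.

Lemma hminusE (a : R[i]) (psi phi : Hminus ip A) f :
  (a *: psi + phi) f = a * psi f + phi f.
Proof. by []. Qed.

Lemma hminus_ext (psi phi : Hminus ip A) : (forall f, psi f = phi f) -> psi = phi.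
Proof. by move=> eq_psi; apply: val_inj; apply/funext. Qed.

Lemma bop_Re_sym B f g : bop_Re B f g = (bop_Re B g f)^*.
Proof.
have -> : bop_Re B f g = 2^-1 * (B f g + (B g f)^*) by [].
have -> : bop_Re B g f = 2^-1 * (B g f + (B f g)^*) by [].
by rewrite rmorphM rmorphD /= conjCK fmorphV rmorph_nat addrC.
Qed.

Lemma bop_Re_linear B : linear (bop_Re B).
Proof.
move=> c f g; rewrite /bop_Re !linearP /= scalerA mulrC -scalerA -scalerDr.
by congr (_ *: _); rewrite scalerDr addrACA.
Qed.

Lemma bop_ReIm B f : B f = bop_Re B f + 'i *: bop_Im B f.
Proof.
rewrite /bop_Re /bop_Im scalerA.
have -> : 'i * (2 * 'i)^-1 = 2^-1 :> R[i].
  by rewrite invfM mulrCA divff ?mulr1 // neq0Ci.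
rewrite -scalerDr addrACA subrr addr0 -mulr2n -scalerMnr scalerMnl -mulr_natr.
by rewrite mulVf ?scale1r ?pnatr_eq0.
Qed.

Definition Re_shift B z f := bop_Re B f - z *: emb ip A (hp_val f).

Lemma Re_shiftE B z f g :
  Re_shift B z f g = bop_Re B f g - z * ip (hp_val f) (hp_val g).
Proof. by []. Qed.

Lemma Re_shift_linear B z : linear (Re_shift B z).
Proof.
move=> c f g; apply: hminus_ext => h.
rewrite [RHS]hminusE !Re_shiftE bop_Re_linear (hminusE c).
have -> : hp_val (c *: f + g) = c *: hp_val f + hp_val g by [].
by rewrite linearDl linearZl_LR /= /GRing.scale /=; ring.
Qed.

Lemma Re_shiftZ B z c f : Re_shift B z (c *: f) = c *: Re_shift B z f.
Proof.
have shift0 : Re_shift B z 0 = 0.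
  by have := Re_shift_linear B z (-1) 0 0; rewrite scaler0 addr0 scaleN1r addNr.
by have := Re_shift_linear B z c f 0; rewrite shift0 !addr0.
Qed.

(** Pairing with [f] gives [(Re B f, f) = z (f, f)]. The left side is real by symmetry, so a nonreal
    [z] forces [(f, f) = 0]. *)
Lemma bop_Re_inj B z f :
  'Im z != 0 -> Re_shift B z f = 0 -> f = 0.
Proof.
move=> zim /(congr1 (fun psi : Hminus ip A => psi f)).
have -> : Re_shift B z f f =
   bop_Re B f f - z * ip (hp_val f) (hp_val f) by [].
rewrite [RHS](_ : _ = 0) // => /eqP; rewrite subr_eq0 => /eqP eqB.
have ffr : ip (hp_val f) (hp_val f) \is Num.real.
  exact/ger0_real/dnorm_ge0.
have := bop_Re_sym B f f; rewrite eqB rmorphM /= (conj_Creal ffr).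
have [ff0 _|ff0 /(mulIf ff0) zz] := eqVneq (ip (hp_val f) (hp_val f)) 0.
  apply: val_inj; apply/eqP; apply: contraT => f0.
  have : 0 < ip (hp_val f) (hp_val f) by apply: neq0_dnorm_gt0.
  by rewrite ff0 ltxx.
by case/eqP: zim; apply/Creal_ImP/CrealP; rewrite -zz.
Qed.

Lemma channel_adj_linear (K : {linear R[i]^o -> Hminus ip A}) c f g :
  channel_adj K (c *: f + g) = c * channel_adj K f + channel_adj K g.
Proof. by rewrite /channel_adj hminusP rmorphD rmorphM /= conjCK. Qed.

Lemma channel_adjZ (K : {linear R[i]^o -> Hminus ip A}) c f :
  channel_adj K (c *: f) = c * channel_adj K f.
Proof. by rewrite /channel_adj hminusZ rmorphM /= conjCK. Qed.

(** Here [Im = K K^*] enters: the state-space operator is a rank-one perturbation of its real part,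
    in the direction [K 1]. *)
Lemma state_opE Theta f :
  state_op Theta f = bop_Re (state_op Theta) f +
    ('i * channel_adj (channel Theta) f) *: channel Theta 1.
Proof.
rewrite [LHS]bop_ReIm channel_eq; congr (_ + _); rewrite -scalerA; congr (_ *: _).
by rewrite -[X in channel _ X]mulr1 -[_ * 1]/(_ *: _) linearZ.
Qed.

(** Injectivity off the real axis makes the choice in [resolvent] agree with any exhibited
    solution. *)
Lemma resolvent_Re B z psi f :
  'Im z != 0 -> Re_shift B z f = psi -> resolvent (bop_Re B) z psi = f.
Proof.
move=> zim fE; apply: xget_unique => // g gE; apply/eqP.
rewrite -subr_eq0; apply/eqP; apply: (bop_Re_inj B z _ zim).
have -> : g - f = (-1) *: f + g by rewrite scaleN1r addrC.
by rewrite Re_shift_linear fE [Re_shift B z g]gE scaleN1r addNr.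
Qed.

Lemma impedanceE Theta z f :
  'Im z != 0 -> Re_shift (state_op Theta) z f = channel Theta 1 ->
  impedance_function Theta z = channel_adj (channel Theta) f.
Proof. by move=> zim fE; rewrite /impedance_function (resolvent_Re _ _ _ _ zim fE). Qed.

(* The junk value [resolvent = 0] would give [V = 0], so a nonzero impedance
   already guarantees that the resolvent equation is solvable. *)
Lemma impedance_solution Theta z :
  'Im z != 0 -> impedance_function Theta z != 0 ->
  exists2 f, Re_shift (state_op Theta) z f = channel Theta 1 &
    impedance_function Theta z = channel_adj (channel Theta) f.
Proof.
move=> zim V0.
have [[f fE]|nosol] := pselect (exists f, Re_shift (state_op Theta) z f = channel Theta 1).
  by exists f => //; apply: impedanceE.
case/eqP: V0; rewrite /impedance_function /resolvent xgetPN.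
  by rewrite -(scale0r 0) channel_adjZ mul0r.
by move=> f fE; apply: nosol; exists f.
Qed.

(* With [V = K^* f0] for the solution [f0] of [(Re A - z) f0 = K 1], the unique
   solution of [(A - z) f = K 1] is [f = f0 / (1 + i V)]. *)
Lemma transfer_impedance Theta z :
  let V := impedance_function Theta z in
  'Im z != 0 -> V != 0 -> 1 + 'i * V != 0 ->
  transfer_function Theta z = (1 - 'i * V) / (1 + 'i * V).
Proof.
move=> V zim V0 iV0; have [f0 f0E VE] := impedance_solution _ _ zim V0.
have stE f : state_op Theta f - z *: emb ip A (hp_val f) =
    Re_shift (state_op Theta) z f + ('i * channel_adj (channel Theta) f) *: channel Theta 1.
  by rewrite state_opE addrAC.
rewrite /transfer_function.
have -> : resolvent (state_op Theta) z (channel Theta 1) = (1 + 'i * V)^-1 *: f0.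
  apply: xget_unique => /= [|g].
    rewrite stE Re_shiftZ f0E channel_adjZ -VE -/V -scalerDl -[RHS]scale1r; congr (_ *: _).
    by field.
  rewrite stE => gE; set w := channel_adj _ g in gE.
  (* Uniqueness: moving the rank-one term to the right leaves [(Re - z) g = (1 - i w) K 1], so [g]
     is a multiple of [f0]. Applying [K^*] then gives [w = (1 - i w) V], which determines the
     factor. *)
  have gf : g = (1 - 'i * w) *: f0.
    apply/eqP; rewrite -subr_eq0; apply/eqP; apply: (bop_Re_inj (state_op Theta) z _ zim).
    have -> : g - (1 - 'i * w) *: f0 = (- (1 - 'i * w)) *: f0 + g.
      by rewrite scaleNr addrC.
    rewrite Re_shift_linear f0E; apply: hminus_ext => h.
    have gh : Re_shift (state_op Theta) z g h + 'i * w * channel Theta 1 h =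
        channel Theta 1 h by rewrite -[in RHS]gE.
    rewrite (hminusE (- (1 - 'i * w))) [RHS](_ : _ = 0) //.
    have -> : Re_shift (state_op Theta) z g h = channel Theta 1 h - 'i * w * channel Theta 1 h.
      by rewrite -{1}gh addrK.
    by ring.
  have wE : w = (1 - 'i * w) * V by rewrite /w {1}gf channel_adjZ -VE.
  rewrite {1}gf; congr (_ *: _); apply: (mulIf iV0); rewrite mulVf //.
  by rewrite mulrDr mulr1 mulrCA -wE subrK.
rewrite channel_adjZ -VE -/V; by field.
Qed.

End Impedance.

(** * Deficiency vectors and the impedance at [- i] *)

Section DeficiencyVectors.
Context {R : realType} {H : completeNormedModType R[i]}.
Variables (ip : {dot H for Num.conj}) (A : set (H * H)).
Hypothesis ip_norm : forall x : H, ip x x = `|x| ^+ 2.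
Hypothesis A_dense : dense (opdom A).

(** The adjoint multiplies [g] by a unimodular number, so the two terms of [ip_plus g g]
    coincide. *)
Lemma deficiency_norm (z : R[i]) (g : Hplus ip A) :
  z * z^* = 1 -> eigenset (adjoint ip A) z (hp_val g) -> norm_plus g = 1 ->
  ip (hp_val g) (hp_val g) = 2^-1.
Proof.
move=> zz gz /(congr1 (fun c => c ^+ 2)); rewrite expr1n /norm_plus sqrtCK.
rewrite /ip_plus (opapp_adjoint _ ip_norm _ _ _ A_dense gz).
rewrite linearZl_LR /= linearZr_LR /= /GRing.scale /= mulrA zz mul1r => h.
by apply: (mulIf (_ : 2 != 0)); rewrite ?pnatr_eq0 // mulVf ?pnatr_eq0 // mulr_natr mulr2n.
Qed.

Variables (gp gm : Hplus ip A).
Hypothesis gp_ker : eigenset (adjoint ip A) 'i (hp_val gp).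
Hypothesis gm_ker : eigenset (adjoint ip A) (- 'i) (hp_val gm).

Lemma adjoint_deficiency (c : R[i]) f k :
  f = hp_val gp + c *: hp_val gm -> adjoint ip A (f, k) ->
  k = 'i *: hp_val gp - ('i * c) *: hp_val gm.
Proof.
move=> -> fk; apply: (adjoint_fun _ ip_norm _ _ _ _ A_dense fk).
have := adjointP c gm_ker gp_ker; rewrite /adjoint /= => h g l /h /=.
rewrite scalerA mulrN [c * _]mulrC scaleNr.
by rewrite [X in ip l X]addrC [X in ip g X]addrC.
Qed.

Hypothesis gp_normalized : norm_plus gp = 1.
Hypothesis gm_normalized : norm_plus gm = 1.

Lemma impedance_Ni (Theta : Lsystem ip A) (kappa : R) :
  0 <= kappa -> kappa < 1 ->
  opdom (main_op Theta) (hp_val gp - kappa%:C *: hp_val gm) ->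
  opdom (quasi_kernel (state_op Theta)) (hp_val gp + hp_val gm) ->
  impedance_function Theta (- 'i) = - ('i * ((1 + kappa) / (1 - kappa))%:C).
Proof.
move=> kappa_ge0 kappa_lt1 [w' Tw'] [w Aw].
pose u := gp + gm; pose t := gp - kappa%:C *: gm.
have uE : hp_val u = hp_val gp + hp_val gm by [].
have tE : hp_val t = hp_val gp - kappa%:C *: hp_val gm by [].
(* The quasi-kernel is self-adjoint and extends [A], hence is a restriction of the adjoint of
   [A]. *)
have ReuE : bop_Re (state_op Theta) u = emb ip A ('i *: hp_val gp - 'i *: hp_val gm).
  have [_ _ [[_ Asa] AA]] := state_star_ext Theta.
  have [f fE Ref] := Aw.
  have -> : u = f by apply: val_inj; rewrite /= fE.
  rewrite Ref /=; congr emb; rewrite -[in RHS](mulr1 'i) {1}mulr1.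
  apply: adjoint_deficiency; last by apply: (adjoint_sub ip _ _ AA); rewrite -Asa; exact: Aw.
  by rewrite scale1r.
have RetE : state_op Theta t = emb ip A ('i *: hp_val gp + ('i * kappa%:C) *: hp_val gm).
  have [[_ TA] _ _] := state_star_ext Theta.
  have [_ TAs] := main_ext Theta.
  have [f fE Tf] := TA _ Tw'.
  have -> : t = f by apply: val_inj; rewrite /= fE.
  rewrite Tf /=; congr emb.
  rewrite -[_ * _]opprK -mulrN scaleNr.
  by apply: adjoint_deficiency (TAs _ Tw'); rewrite scaleNr.
have pE : ip (hp_val gp) (hp_val gp) = 2^-1.
  by apply: deficiency_norm gp_ker gp_normalized; rewrite conjCi mulrN -expr2 sqrCi opprK.
have qE : ip (hp_val gm) (hp_val gm) = 2^-1.
  by apply: deficiency_norm gm_ker gm_normalized; rewrite rmorphN /= conjCi opprK mulNr -expr2 sqrCi opprK.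
set B := bop_Re _ in ReuE *; set k := channel Theta 1.
pose K := channel_adj (channel Theta).
have Bu g : B u g = 'i * ip (hp_val gp) (hp_val g) - 'i * ip (hp_val gm) (hp_val g).
  by rewrite ReuE /= linearBl !linearZl_LR.
have Bt g : B t g = 'i * ip (hp_val gp) (hp_val g)
    + 'i * kappa%:C * ip (hp_val gm) (hp_val g) - 'i * K t * k g.
  have : (state_op Theta t) g = B t g + 'i * K t * k g by rewrite state_opE.
  by rewrite RetE /= linearDl !linearZl_LR /= /GRing.scale /= => ->; rewrite addrK.
have kE g : k g = (K g)^* by rewrite conjCK.
have kapR : (kappa%:C)^* = kappa%:C :> R[i] by apply: conj_Creal; apply/complex_realP; exists kappa.
pose r := ip (hp_val gp) (hp_val gm).
have rE : ip (hp_val gm) (hp_val gp) = r^* by apply: ipC.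
have gpu : ip (hp_val gp) (hp_val u) = 2^-1 + r by rewrite uE linearDr /= pE.
have gmu : ip (hp_val gm) (hp_val u) = r^* + 2^-1 by rewrite uE linearDr /= rE qE.
have gpt : ip (hp_val gp) (hp_val t) = 2^-1 - kappa%:C * r.
  by rewrite tE linearBr linearZr_LR /= kapR pE.
have gmt : ip (hp_val gm) (hp_val t) = r^* - kappa%:C * 2^-1.
  by rewrite tE linearBr linearZr_LR /= kapR rE qE.
have halfR : (2^-1)^* = 2^-1 :> R[i] by rewrite fmorphV rmorph_nat.
(* Symmetry of [B] on the pair [t], [u]; the unknown inner product [r] cancels. *)
have Ktu : K t * (K u)^* = 1 + kappa%:C.
  have := bop_Re_sym _ _ (state_op Theta) t u; rewrite -/B Bu Bt kE gpu gmu gpt gmt.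
  rewrite !(rmorphB, rmorphM, rmorphD) /= !conjCK kapR conjCi halfR.
  move=> Bsym; apply: (mulfI (neq0Ci R[i])); apply: (eq_from_sub _ _ Bsym); by field.
(* The same symmetry on the pair [t], [t]: [B t t] is real, and [r] cancels again. *)
have Ktt : 2 * (K t * (K t)^*) = 1 - kappa%:C ^+ 2.
  have := bop_Re_sym _ _ (state_op Theta) t t; rewrite -/B Bt kE gpt gmt.
  rewrite !(rmorphB, rmorphM, rmorphD) /= !conjCK kapR conjCi halfR.
  move=> Bsym; apply: (mulfI (neq0Ci R[i])); apply: (eq_from_sub _ _ Bsym); by field.
have kap1 : 1 - kappa%:C != 0 :> R[i].
  by rewrite -(rmorphB (real_complex R)) fmorph_eq0 subr_eq0 gt_eqF.
have kap2 : 1 + kappa%:C != 0 :> R[i].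
  by rewrite -(rmorphD (real_complex R)) fmorph_eq0 gt_eqF // ltr_pwDl.
have Kt0 : K t != 0.
  by apply: contra_neq kap2 => Kt0; rewrite -Ktu Kt0 mul0r.
have Ktt0 : (K t)^* != 0 by rewrite conjC_eq0.
have gmE : u - t = (1 + kappa%:C) *: gm.
  by rewrite /u /t scalerDl scale1r opprB [_ - gp]addrC addrACA subrr add0r.
have iKt : 'i * K t != 0 by rewrite mulf_neq0 ?neq0Ci.
(* The adjoint of [A] plus [i] kills [u - t], a multiple of [gm]. In [(B + i)(u - t)] only the
   rank-one correction coming from [t] survives, namely [i K t] times [K 1]. *)
rewrite (impedanceE _ _ _ _ (('i * K t)^-1 *: (u - t))).
(* The quotient of [Ktu] and [Ktt] gives the ratio of [K u] to [K t], which is all that the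
   impedance depends on. *)
- have KuE : K u = 2 * K t / (1 - kappa%:C).
    apply: (mulfI Ktt0); apply: (mulfI kap1).
    have -> : (K t)^* * K u = 1 + kappa%:C.
      by rewrite -[K u]conjCK -rmorphM /= Ktu rmorphD rmorph1 /= kapR.
    transitivity (2 * (K t * (K t)^*)); first by rewrite Ktt; ring.
    by field.
  rewrite channel_adjZ -/K; have -> : K (u - t) = K u - K t.
    have -> : u - t = (-1) *: t + u by rewrite scaleN1r addrC.
    by rewrite /K channel_adj_linear mulN1r addrC.
  rewrite KuE rmorphM rmorphD rmorph1 fmorphV rmorphB rmorph1 /= -[in RHS]mulNr -invCi.
  by field; apply/and3P; split=> //; exact: neq0Ci.
- by rewrite -conjCi Im_conj Im_i oppr_eq0 oner_eq0.
- rewrite Re_shiftZ; apply: (canLR (scalerK iKt)).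
  have -> : u - t = (-1) *: t + u by rewrite scaleN1r addrC.
  rewrite Re_shift_linear; apply: hminus_ext => g; rewrite (hminusE _ _ (-1)).
  rewrite !Re_shiftE -/B Bu Bt.
  rewrite uE tE linearBl !linearDl !linearZl_LR /= /GRing.scale /=.
  by rewrite -[RHS]/('i * K t * k g); ring.
Qed.

End DeficiencyVectors.

(** * Scalar computations: Cayley transform, hyperbolic cotangent, closed form *)

Section Entropy.
Context {R : realType}.

Lemma cayley_normc (x y : R) : 0 < y ->
  let V := x%:C - 'i * y%:C in
  1 + 'i * V != 0 /\
  Normc.normc ((1 - 'i * V) / (1 + 'i * V)) =
    Num.sqrt ((y - 1) ^+ 2 + x ^+ 2) / Num.sqrt ((y + 1) ^+ 2 + x ^+ 2).
Proof.
move=> y0 V; have iVE : 'i * V = y +i* x.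
  rewrite /V mulrBr mulrA -expr2 sqrCi mulN1r opprK -complexiE.
  by apply/eqP; rewrite eq_complex /= !mul0r !mul1r !subr0 !add0r !addr0 !eqxx.
have V1 : 1 + 'i * V = (y + 1) +i* x.
  by rewrite iVE; apply/eqP; rewrite eq_complex /= add0r addrC !eqxx.
have V2 : 1 - 'i * V = (1 - y) +i* - x.
  by rewrite iVE; apply/eqP; rewrite eq_complex /= add0r !eqxx.
split.
  by rewrite V1 eq_complex /= negb_and gt_eqF // addr_gt0.
rewrite Normc.normcM Normc.normcV V1 V2 /= sqrrN.
by rewrite -[1 - y]opprB sqrrN.
Qed.

(** With [e = c^(-1/2)] both sides equal [(e^2 + 1) / (e^2 - 1)]. Used with [c = kappa], where
    [S = - ln kappa]. *)
Lemma coth_half_ln (c : R) : 0 < c -> c < 1 ->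
  coth (- ln c / 2) = (1 + c) / (1 - c).
Proof.
move=> c0 c1; rewrite /coth; set e := expR (- ln c / 2).
have e0 : 0 < e by apply: expR_gt0.
have cE : c = (e ^+ 2)^-1.
  by rewrite /e expr2 -expRD -splitr expRN lnK ?invrK // posrE.
have e1 : 1 < e ^+ 2.
  by rewrite -(invrK (e ^+ 2)) -cE invf_gt1.
rewrite expRN -/e cE.
have e2 : e ^+ 2 - 1 != 0 by rewrite subr_eq0 gt_eqF.
by field; rewrite e2 lt0r_neq0.
Qed.

(** [P] and [M] are the squared moduli of [1 + i V] and [1 - i V] at [V = Q - i a], so the right
    side is the reciprocal of the modulus of the perturbed transfer function. *)
Lemma entropy_ratio (a Q : R) : 1 < a -> Q != 0 ->
  let b := Q ^+ 2 + a ^+ 2 - 1 in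
  let s := Num.sqrt (b ^+ 2 + 4 * Q ^+ 2) in
  let P := (a + 1) ^+ 2 + Q ^+ 2 in
  let M := (a - 1) ^+ 2 + Q ^+ 2 in
  ((b - 2 * Q ^+ 2 + s) ^+ 2 + a * (b + s) ^+ 2 + 4 * Q ^+ 2 * a * (a + 1))
    / (a * (b + s) ^+ 2 - (b - 2 * Q ^+ 2 + s) ^+ 2 - 4 * Q ^+ 2 * a * (a - 1))
  = Num.sqrt P / Num.sqrt M.
Proof.
move=> a1 Q0 b s P M.
have Q2 : 0 < Q ^+ 2 by rewrite exprn_even_gt0.
have b0 : 0 < b by rewrite /b; nra.
have P0 : 0 < P by rewrite /P; nra.
have M0 : 0 < M by rewrite /M; nra.
have sE : s ^+ 2 = b ^+ 2 + 4 * Q ^+ 2.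
  by rewrite sqr_sqrtr // addr_ge0 ?sqr_ge0 // mulr_ge0 ?ltW.
(* [b ^ 2 + 4 Q ^ 2 = P M], and the fraction equals [P / s]. *)
have sPM : s = Num.sqrt P * Num.sqrt M.
  by rewrite -sqrtrM ?ltW //; congr Num.sqrt; rewrite /b /P /M; ring.
have bs : b < s by rewrite -(ltr_pXn2r (n := 2)) ?nnegrE ?sqrtr_ge0 ?(ltW b0) // sE; nra.
set N := (X in X / _); set D := (X in _ / X).
(* Since [(b + s)^2 = 2 b (b + s) + 4 Q^2], both [N] and [D] become affine in [s]. *)
have NE : N = (b + s) * (2 * b * (a + 1) - 4 * Q ^+ 2) + 4 * Q ^+ 2 * P.
  by rewrite /N /P; ring: sE.
have DE : D = (b + s) * (2 * b * (a - 1) + 4 * Q ^+ 2) - 4 * Q ^+ 2 * M.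
  by rewrite /D /M; ring: sE.
have Q4 : 0 < 4 * Q ^+ 2 by rewrite mulr_gt0.
have a10 : 0 < a - 1 by rewrite subr_gt0.
(* [D] is affine in [s] with positive slope and [s > b], so positivity of its value at [s = b]
   suffices. *)
have D0 : 0 < D.
  have : 2 * b * (2 * b * (a - 1) + 4 * Q ^+ 2) - 4 * Q ^+ 2 * M > 0.
    have -> : 2 * b * (2 * b * (a - 1) + 4 * Q ^+ 2) - 4 * Q ^+ 2 * M =
        4 * b ^+ 2 * (a - 1) + 4 * Q ^+ 2 * (Q ^+ 2 + (a - 1) * (a + 3)).
      by rewrite /M /b; ring.
    apply: ltr_wpDl; first by rewrite !mulr_ge0 ?sqr_ge0 // ltW.
    apply: mulr_gt0 => //; apply: ltr_pwDl => //; apply: mulr_ge0; lra.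
  have : 0 < (s - b) * (2 * b * (a - 1) + 4 * Q ^+ 2).
    rewrite mulr_gt0 ?subr_gt0 //.
    by apply: addr_gt0 => //; apply: mulr_gt0; rewrite // mulr_gt0.
  by rewrite DE; lra.
have NsDP : N * s = D * P.
  by rewrite NE DE; move: sE; rewrite /P /M /b => sE; ring: sE.
have sP : Num.sqrt P != 0 by rewrite gt_eqF // sqrtr_gt0.
have sM : Num.sqrt M != 0 by rewrite gt_eqF // sqrtr_gt0.
apply: (mulIf sM); rewrite divfK //; apply: (mulIf (lt0r_neq0 D0)).
rewrite mulrAC divfK ?gt_eqF //; apply: (mulIf sP).
rewrite -mulrA [_ M * _]mulrC -sPM NsDP -[P in LHS]sqr_sqrtr ?ltW //; ring.
Qed.

Lemma entropy_impedance {H : completeNormedModType R[i]}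
    (ip : {dot H for Num.conj}) (A : set (H * H)) (Theta : Lsystem ip A) (x y : R) :
  0 < y -> impedance_function Theta (- 'i) = x%:C - 'i * y%:C ->
  c_entropy Theta =
    (- lne (Num.sqrt ((y - 1) ^+ 2 + x ^+ 2) / Num.sqrt ((y + 1) ^+ 2 + x ^+ 2))%:E)%E.
Proof.
move=> y0 VE; have [V1 normW] := cayley_normc x y y0.
rewrite /c_entropy transfer_impedance ?VE ?normW //.
  by rewrite -conjCi Im_conj Im_i oppr_eq0 oner_eq0.
(* The impedance is nonzero because its imaginary part is [- y]. *)
rewrite -complexiE; apply/eqP => /(congr1 (@complex.Im R)) /=.
by rewrite !mul1r !mul0r => h; lra.
Qed.

End Entropy.

Theorem theorem8 (R : realType) (H : completeNormedModType R[i])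
    (ip : {dot H for Num.conj}) (ip_norm : forall x : H, ip x x = `|x| ^+ 2)
    (A : set (H * H))
    (A_sym : symmetric_operator ip A) (A_closed : closed A)
    (A_dense : dense (opdom A)) (A_def : deficiency_indices ip A 1 1)
    (gp gm : Hplus ip A)
    (gp_ker : eigenset (adjoint ip A) 'i (hp_val gp))
    (gm_ker : eigenset (adjoint ip A) (- 'i) (hp_val gm))
    (gp_normalized : norm_plus gp = 1) (gm_normalized : norm_plus gm = 1)
    (Theta : Lsystem ip A)
    (T_neq : main_op Theta <> adjoint ip (main_op Theta))
    (T_max : maximal_dissipative ip (main_op Theta))
    (kappa : R) (kappa_ge0 : 0 <= kappa) (kappa_lt1 : kappa < 1)
    (T_dom : opdom (main_op Theta) (hp_val gp - kappa%:C *: hp_val gm))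
    (Ahat_dom : opdom (quasi_kernel (state_op Theta)) (hp_val gp + hp_val gm))
    (S : R) (S_entropy : c_entropy Theta = S%:E)
    (Q : R) (Q_neq0 : Q != 0)
    (ThetaQ : Lsystem ip A) (ThetaQ_pert : perturbation Q Theta ThetaQ) :
  let a := coth (S / 2) in
  let b := Q ^+ 2 + a ^+ 2 - 1 in
  let s := Num.sqrt (b ^+ 2 + 4 * Q ^+ 2) in
  c_entropy ThetaQ =
    (ln (((b - 2 * Q ^+ 2 + s) ^+ 2 + a * (b + s) ^+ 2
            + 4 * Q ^+ 2 * a * (a + 1))
         / (a * (b + s) ^+ 2 - (b - 2 * Q ^+ 2 + s) ^+ 2
            - 4 * Q ^+ 2 * a * (a - 1))))%:E.
Proof.
move=> a b s.
have VE := impedance_Ni ip A ip_norm A_dense gp gm gp_ker gm_ker gp_normalized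
  gm_normalized Theta kappa kappa_ge0 kappa_lt1 T_dom Ahat_dom.
set m := (1 + kappa) / (1 - kappa) in VE.
have m1 : 1 <= m by rewrite /m ler_pdivlMr ?subr_gt0 // mul1r; lra.
have m0 : 0 < m by lra.
have Ni : 'Im (- 'i : R[i]) != 0 by rewrite -conjCi Im_conj Im_i oppr_eq0 oner_eq0.
have VQE : impedance_function ThetaQ (- 'i) = Q%:C - 'i * m%:C.
  by rewrite (ThetaQ_pert _ Ni) VE.
have V0E : impedance_function Theta (- 'i) = 0%:C - 'i * m%:C by rewrite sub0r.
have := entropy_impedance _ _ _ _ _ m0 V0E; rewrite S_entropy expr0n /= !addr0.
rewrite !sqrtr_sqr !ger0_norm ?subr_ge0 ?addr_ge0 ?(ltW m0) //.
have -> : (m - 1) / (m + 1) = kappa.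
  rewrite /m; field; apply/andP; split; apply/eqP; lra.
(* For [kappa = 0] the transfer function vanishes at [- i] and the entropy is [+oo], contradicting
   its finiteness. *)
have [kappa0|kappa_neq0] := eqVneq kappa 0; first by rewrite kappa0 lexx.
have kappa_gt0 : 0 < kappa by rewrite lt_neqAle eq_sym kappa_neq0.
rewrite leNgt kappa_gt0 /= => -[SE].
have am : a = m by rewrite /a SE coth_half_ln.
have a1 : 1 < a by rewrite am /m ltr_pdivlMr ?subr_gt0 // mul1r; lra.
rewrite (entropy_impedance _ _ _ _ _ m0 VQE) (entropy_ratio a Q a1 Q_neq0) am.
set P := (m + 1) ^+ 2 + _; set M := (m - 1) ^+ 2 + _.
have Q2 : 0 < Q ^+ 2 by rewrite exprn_even_gt0.
have P0 : 0 < P by rewrite ltr_wpDl ?sqr_ge0.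
have M0 : 0 < M by rewrite ltr_wpDl ?sqr_ge0.
by rewrite -[Num.sqrt M / _]invf_div lneV ?divr_gt0 ?sqrtr_gt0 // oppeK lne_EFin // divr_gt0 ?sqrtr_gt0.
Qed.
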